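(* For any positive integer $n$ and any real $\varepsilon$ with $0\leq\varepsilon<1/3$, there exists a set of $n$ points in $[0,1]$ that contains no $\varepsilon$-approximate arithmetic progression of $3$ terms.
   Context: A $3$-point set $Q\subset\mathbb{R}$ is an $\varepsilon$-approximate arithmetic progression of $3$ terms if it is an $\varepsilon$-approximate homothetic copy of $\{1,2,3\}$, i.e. there exist a set $Q'=\{q'_1,q'_2,q'_3\}=\lambda\{1,2,3\}+v$ with $\lambda>0$, $v\in\mathbb{R}$, and a labeling $Q=\{q_1,q_2,q_3\}$ by distinct points such that $|q_i-q'_i|\leq \varepsilon m$ for each $i$, where $m$ is the minimum pairwise distance among points of $Q'$ (so $m=\lambda$). A set contains such a progression if some $3$-point subset of it is one. *)

(* Defs.v *)
From mathcomp Require Import all_boot all_order all_algebra.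
From mathcomp Require Import all_classical all_reals.

Set Implicit Arguments.
Unset Strict Implicit.
Unset Printing Implicit Defensive.

Import Order.TTheory GRing.Theory Num.Theory.
Local Open Scope classical_set_scope.
Local Open Scope ring_scope.

(* For a finite set with at least two points the infimum is attained, so this
   is the minimum; [inf] takes the value 0 on smaller sets. *)
Definition min_dist (R : realType) (A : set R) : R :=
  inf [set d | exists x y : R, [/\ A x, A y, x != y & d = `|x - y|]].

Definition homothetic_image (R : realType) (l v : R) (P : set R) : set R :=
  [set l * x + v | x in P].

(* The labelings [q'] of the exact copy and [q] of [Q] may list the points in
   any order: only corresponding labels have to be close. *)
Definition approx_homothetic_copy (R : realType) (k : nat) (eps : R)
    (P Q : set R) : Prop :=
  exists (l v : R) (q' q : 'I_k -> R),
    [/\ 0 < l,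
        injective q' /\ range q' = homothetic_image l v P,
        injective q /\ range q = Q
      & forall i, `|q i - q' i| <= eps * min_dist (range q')].

Definition approx_AP3 (R : realType) (eps : R) (Q : set R) : Prop :=
  approx_homothetic_copy 3 eps [set 1; 2; 3] Q.

Definition contains_approx_AP3 (R : realType) (eps : R) (A : set R) : Prop :=
  exists2 Q : set R, Q `<=` A & approx_AP3 eps Q.

(* Main.v *)
Require Import Defs.
From mathcomp Require Import all_boot all_order all_algebra.
From mathcomp Require Import all_classical all_reals.
From mathcomp Require Import lra.

Import Order.TTheory GRing.Theory Num.Theory.
Local Open Scope classical_set_scope.
Local Open Scope ring_scope.

(** Take the points [6^-k] for [k < n]. In an [eps]-approximate progression
    [a, b, c] with [eps < 1/3] and difference [l], one has [b - a > l / 3] and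
    [c - b < 5 l / 3], so [a < b < c] and [c - b < 5 (b - a)]; if [a] is
    nonnegative this gives [c < 6 b]. But two powers [b < c] of [6] always
    satisfy [6 b <= c]. *)

Lemma min_dist_le_dist (R : realType) (A : set R) (x y : R) :
  A x -> A y -> x != y -> min_dist A <= `|x - y|.
Proof.
move=> Ax Ay xy; apply: ge_inf; last by exists x, y.
by exists 0 => _ [u [w [_ _ _ ->]]]; exact: normr_ge0.
Qed.

(** The labelings come in arbitrary order, so [a], [b], [c] are the values of [q] at the labels that
    [q'] gives to the images of 1, 2, 3. *)
Lemma approx_AP3P (R : realType) (eps : R) (Q : set R) :
  0 <= eps -> approx_AP3 eps Q ->
  exists l v a b c : R,
    [/\ 0 < l, [/\ Q a, Q b & Q c],
        `|a - (l + v)| <= eps * l,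
        `|b - (2 * l + v)| <= eps * l
      & `|c - (3 * l + v)| <= eps * l].
Proof.
move=> eps_ge0 [l [v [q' [q [l_gt0 [_ q'E] [_ qE] close]]]]].
have label k : [set 1; 2; 3] k -> range q' (k * l + v).
  by move=> Pk; rewrite q'E; exists k => //; rewrite mulrC.
have P1 : [set 1; 2; 3] (1 : R) by left; left.
have P2 : [set 1; 2; 3] (2 : R) by left; right.
have P3 : [set 1; 2; 3] (3 : R) by right.
(* The images of 1 and 2 lie at distance [l], which bounds the minimum from above. *)
have min_le : eps * min_dist (range q') <= eps * l.
  apply: ler_wpM2l => //.
  have -> : l = `|2 * l + v - (1 * l + v)|.
    by rewrite [X in `|X|](_ : _ = l) ?gtr0_norm //; lra.
  by apply: min_dist_le_dist; [exact: label|exact: label|apply/eqP; lra].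
have [i1 _ E1] := label _ P1.
have [i2 _ E2] := label _ P2.
have [i3 _ E3] := label _ P3.
rewrite mul1r in E1.
exists l, v, (q i1), (q i2), (q i3); split => //.
- by rewrite -qE; split; eexists.
- by rewrite -E1; exact: le_trans (close _) min_le.
- by rewrite -E2; exact: le_trans (close _) min_le.
- by rewrite -E3; exact: le_trans (close _) min_le.
Qed.

Lemma approx_AP3_lt6 (R : realType) (eps : R) (Q : set R) :
  0 <= eps -> eps < 1 / 3 -> (forall x, Q x -> 0 <= x) -> approx_AP3 eps Q ->
  exists b c : R, [/\ Q b, Q c, b < c & c < 6 * b].
Proof.
move=> eps_ge0 eps_lt Q_ge0 /(approx_AP3P _ _ _ eps_ge0).
move=> [l [v [a [b [c [l_gt0 [Qa Qb Qc] Ha Hb Hc]]]]]].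
have epsl : eps * l < l / 3 by rewrite mulrC ltr_pM2l // -div1r.
have a_ge0 := Q_ge0 _ Qa.
move: Ha Hb Hc; rewrite !ler_norml => /andP[? ?] /andP[? ?] /andP[? ?].
by exists b, c; split=> //; lra.
Qed.

(** Powers of a base in (0, 1) decrease, so [i < j]; the factor 6 cancels one [6^-1], and the
    exponent [j - 1] that is left is still at least [i]. *)
Lemma expr_inv6_gap (R : realType) (i j : nat) :
  (6^-1 : R) ^+ j < 6^-1 ^+ i -> 6 * 6^-1 ^+ j <= (6^-1 : R) ^+ i.
Proof.
rewrite ltr_iXn2l ?invr_gt0 ?invf_lt1 ?ltr1n// => ij.
rewrite -(prednK (leq_ltn_trans (leq0n _) ij)) exprS mulVKf ?pnatr_eq0//.
by rewrite ler_iXn2l ?invr_gt0 ?invf_lt1 ?ltr1n// -ltnS (ltn_predK ij).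
Qed.

Theorem proposition1 (R : realType) (n : nat) (eps : R)
    (n_gt0 : (0 < n)%N) (eps_ge0 : 0 <= eps) (eps_lt : eps < 1 / 3) :
  exists A : set R,
    [/\ (A #= `I_n)%card, A `<=` `[0, 1] & ~ contains_approx_AP3 eps A].
Proof.
exists [set (6^-1 : R) ^+ k | k in `I_n]; split.
(* The powers are pairwise distinct because the base is positive and differs from 1. *)
- apply: inj_card_eq => i j _ _.
  by apply: ieexprIn; rewrite ?invr_gt0 ?invr_eq1 ?(eqr_nat R 6 1).
- move=> _ [k _ <-] /=.
  by rewrite in_itv /= exprn_ge0 ?exprn_ile1 ?invr_ge0 ?invf_le1 ?ler1n.
- move=> [Q QA QAP].
  have Q_ge0 x : Q x -> 0 <= x.
    by move=> /QA[k _ <-]; rewrite exprn_ge0 ?invr_ge0.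
  have [_ [_ [/QA[j _ <-] /QA[i _ <-] bc]]] :=
    approx_AP3_lt6 _ _ _ eps_ge0 eps_lt Q_ge0 QAP.
  (* The premise left in the goal, [6^-1 ^+ i < 6 * 6^-1 ^+ j], contradicts the gap that [bc]
     forces. *)
  by rewrite ltNge expr_inv6_gap.
Qed.
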